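(* Let $S\subseteq V(K)$ be a RED:LD set on the infinite king grid $K$. Then the average share of the vertices in $S$ is at most $\frac{11}{3}$.
   Context: The infinite king grid $K$ has vertex set $\mathbb{Z}^2$, with distinct vertices $(a,b),(c,d)$ adjacent iff $\max(|a-c|,|b-d|)=1$. $N(v)$ is the open neighborhood of $v$ and $N[v]=N(v)\cup\{v\}$. A set $S\subseteq V(K)$ is a RED:LD (redundant locating-dominating) set iff (i) for all $v\in V(K)$, $|N[v]\cap S|\ge 2$; (ii) for all $v\in S$ and $u\in V(K)\setminus S$, $|((N(v)\cap S)\triangle(N(u)\cap S))\setminus\{v\}|\ge 1$; (iii) for all distinct $u,v\in V(K)\setminus S$, $|(N(v)\cap S)\triangle(N(u)\cap S)|\ge 2$. For $v\in V(K)$, $dom(v)=|N[v]\cap S|$; the share of a detector $x\in S$ is $sh(x)=\sum_{u\in N[x]}\frac{1}{dom(u)}$. The average share of the vertices in $S$ is $\limsup_{n\to\infty}\frac{1}{|S\cap Q_n|}\sum_{x\in S\cap Q_n} sh(x)$, where $Q_n=\{-n,\dots,n\}^2$; it equals the reciprocal of the density of $S$. *)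

(* Defs.v *)
From HB Require Import structures.
From mathcomp Require Import all_boot all_order all_algebra finmap.
From mathcomp Require Import zify.
From mathcomp Require Import all_classical all_reals all_analysis.

Set Implicit Arguments.
Unset Strict Implicit.
Unset Printing Implicit Defensive.

Import Order.TTheory GRing.Theory Num.Theory.

Local Open Scope classical_set_scope.
Local Open Scope ring_scope.

Definition vertex : Type := (int * int)%type.

Definition king_adj (u v : vertex) : Prop :=
  Num.max `|u.1 - v.1| `|u.2 - v.2| = 1.

Definition nbh (v : vertex) : set vertex := [set u | king_adj v u].

Definition cnbh (v : vertex) : set vertex := nbh v `|` [set v].

(* [fset_set] sends an infinite set to the empty one; [vcard] is only applied
   below to subsets of neighborhoods and boxes, which are finite by
   [finite_nbh], [finite_cnbh] and [finite_box]. *)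
Definition vcard (A : set vertex) : nat := #|` fset_set A|.

Definition redld (S : set vertex) : Prop :=
  [/\ forall v, (2 <= vcard (cnbh v `&` S))%N,
      forall v u, S v -> ~ S u ->
        (1 <= vcard (((nbh v `&` S) `+` (nbh u `&` S)) `\ v))%N
    & forall u v, ~ S u -> ~ S v -> u <> v ->
        (2 <= vcard ((nbh v `&` S) `+` (nbh u `&` S)))%N].

Definition dom (S : set vertex) (v : vertex) : nat := vcard (cnbh v `&` S).

Definition share (R : realType) (S : set vertex) (x : vertex) : R :=
  \sum_(u \in cnbh x) ((dom S u)%:R^-1 : R).

Definition box (n : nat) : set vertex :=
  [set v | - n%:Z <= v.1 <= n%:Z /\ - n%:Z <= v.2 <= n%:Z].

Definition average_share (R : realType) (S : set vertex) : \bar R :=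
  limn_esup (fun n => ((vcard (S `&` box n))%:R^-1 *
                       \sum_(x \in S `&` box n) share R S x : R)%:E).

Lemma finite_square (a b : int) (n : nat) :
  finite_set [set v : vertex | a <= v.1 <= a + n%:Z /\ b <= v.2 <= b + n%:Z].
Proof.
pose f (p : 'I_n.+1 * 'I_n.+1) : vertex := (a + p.1%:Z, b + p.2%:Z).
apply: (@sub_finite_set _ _ (f @` setT)); last first.
  by apply: finite_image; exact: finite_finset.
move=> [x y] /= [hx hy].
exists (inord `|x - a|%N, inord `|y - b|%N) => //.
by rewrite /f /= !inordK; [congr pair|..]; lia.
Qed.

Lemma finite_nbh (v : vertex) : finite_set (nbh v).
Proof.
apply: sub_finite_set (finite_square (v.1 - 1) (v.2 - 1) 2).
by move=> u; rewrite /nbh /king_adj /=; lia.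
Qed.

Lemma finite_cnbh (v : vertex) : finite_set (cnbh v).
Proof. by rewrite finite_setU; split; [exact: finite_nbh|exact: finite_set1]. Qed.

Lemma finite_box (n : nat) : finite_set (box n).
Proof.
apply: sub_finite_set (finite_square (- n%:Z) (- n%:Z) (n + n)).
by move=> u; rewrite /box /=; lia.
Qed.

(* Main.v *)
(** In fact every detector has share at most 11/3. Call a vertex light if it is
    dominated exactly twice and heavy if it is dominated at least four times.
    As 1/2 = 1/3 + 1/6 and 1/4 = 1/3 - 1/12, the bound holds at a detector [x]
    as soon as twice the number of light vertices of [N[x]] exceeds the number
    of heavy ones by at most 8.

    If [v] is light with [N[v]] meeting [S] in [{x, y}], any other vertex [u]
    adjacent to both [x] and [y] has a larger detector set, unless [u] and [v]
    are both detectors; if neither is, the two sets differ twice and [u] is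
    heavy. Light vertices are thus rare around two neighbouring detectors, and
    the bound follows by distinguishing the positions, up to symmetry, of the
    detectors in [N(x)]. Below, [x] is the origin and the compass points name
    its neighbours, with east and north along the first and second
    coordinates. *)

Require Import Defs.
From mathcomp Require Import all_boot all_order all_algebra finmap.
From mathcomp Require Import zify lra.
From mathcomp Require Import all_classical all_reals all_analysis.
Local Open Scope ring_scope.

Set Implicit Arguments.
Unset Strict Implicit.
Unset Printing Implicit Defensive.

Import Order.TTheory GRing.Theory Num.Theory.

Lemma leq_vcard (A B : set vertex) :
  finite_set B -> (A `<=` B)%classic -> (vcard A <= vcard B)%N.
Proof.
move=> finB AB; apply: fsubset_leq_card.
by rewrite -fset_set_sub//; exact: sub_finite_set finB.
Qed.

Lemma vcard_count (A : set vertex) (s : seq vertex) :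
  uniq s -> (A `<=` [set` s])%classic -> vcard A = count (fun v => v \in A) s.
Proof.
move=> us As; have finA : finite_set A by exact: sub_finite_set (finite_seq s).
rewrite /vcard -size_filter -[in RHS](undup_id (filter_uniq _ us)) -card_fseq.
congr #|` _|; apply/fsetP => v; rewrite in_fset_set// !inE mem_filter.
by apply/idP/andP => [Av|[]//]; split=> //; apply: As; exact: set_mem.
Qed.

Lemma count_le_vcard (A : set vertex) (s : seq vertex) :
  finite_set A -> uniq s -> (count (fun v => v \in A) s <= vcard A)%N.
Proof.
move=> finA us.
rewrite (_ : count _ _ = vcard (A `&` [set` s])%classic); last first.
  rewrite (@vcard_count _ s)//; apply: eq_in_count => v vs.
  by rewrite in_setI [X in _ && X](_ : _ = true) ?andbT//; exact: mem_set.
by apply: leq_vcard => // v [].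
Qed.

Lemma vcardD (A B : set vertex) : finite_set B -> (A `<=` B)%classic ->
  vcard (B `\` A)%classic = (vcard B - vcard A)%N.
Proof.
move=> finB AB; have finA := sub_finite_set AB finB.
rewrite /vcard fset_setD// cardfsD.
suff /fsetIidPr-> : (fset_set A `<=` fset_set B)%fset by [].
by rewrite -fset_set_sub.
Qed.

Lemma ltn_vcard (A B : set vertex) :
  finite_set B -> (A `<=` B)%classic -> A <> B -> (vcard A < vcard B)%N.
Proof.
move=> finB AB neqAB; have finA := sub_finite_set AB finB.
apply: fproper_ltn_card; rewrite fproperEneq.
apply/andP; split; last by rewrite -fset_set_sub.
by apply/eqP => eqf; apply: neqAB; exact: fset_set_inj eqf.
Qed.

Lemma vcard_preimage (f : vertex -> vertex) (A : set vertex) :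
  bijective f -> finite_set A -> vcard (f @^-1` A)%classic = vcard A.
Proof.
case=> g fK gK finA; have -> : (f @^-1` A = g @` A)%classic.
  apply/seteqP; split=> [v Av|_ [v Av <-]]; first by exists (f v).
  by rewrite /= gK.
by rewrite /vcard fset_set_image// card_imfset//; exact: can_inj gK.
Qed.

(** * Detector sets *)

Definition king_close (u v : vertex) : bool :=
  (`|u.1 - v.1| <= 1) && (`|u.2 - v.2| <= 1).

Lemma king_closeC (u v : vertex) : king_close u v = king_close v u.
Proof. by rewrite /king_close !(distrC u.1) !(distrC u.2). Qed.

Lemma king_closexx (v : vertex) : king_close v v.
Proof. by rewrite /king_close !subrr. Qed.

Lemma nbhE (v u : vertex) : nbh v u <-> king_close v u /\ u <> v.
Proof.
rewrite /nbh /king_close /king_adj /=; case: v u => [a b] [c d] /=; split.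
  by move=> adj; split; [lia|move=> [ca db]; lia].
case=> close uv; have : ~ (c = a /\ d = b) by case=> ? ?; apply: uv; congr pair.
lia.
Qed.

Lemma cnbhE (v u : vertex) : cnbh v u <-> king_close v u.
Proof.
split=> [[/nbhE[]//|->]|vu]; first exact: king_closexx.
by have [->|/eqP uv] := eqVneq u v; [right|left; apply/nbhE].
Qed.

Definition sees (x y v : vertex) : bool := king_close v x && king_close v y.

Section Detectors.
Variable S : set vertex.

Definition detectors (v : vertex) : set vertex := (cnbh v `&` S)%classic.

Lemma finite_detectors (v : vertex) : finite_set (detectors v).
Proof. by apply: sub_finite_set (finite_cnbh v) => u []. Qed.

Lemma mem_detectors (v u : vertex) :
  (u \in detectors v) = king_close v u && (u \in S).
Proof.
rewrite in_setI; congr andb.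
by apply/idP/idP => [/set_mem/cnbhE|/cnbhE/mem_set].
Qed.

Lemma open_detectors_nondetector (v : vertex) :
  v \notin S -> (nbh v `&` S)%classic = detectors v.
Proof.
move=> /negP vS; apply/seteqP; split=> u [vu Su]; split=> //; first by left.
by case: vu Su => // -> /mem_set.
Qed.

Lemma open_detectors_detector (v : vertex) :
  (nbh v `&` S)%classic = (detectors v `\ v)%classic.
Proof.
apply/seteqP; split=> u.
  by case=> /nbhE[vu uv] Su; split=> //; split=> //; apply/cnbhE.
by case=> -[/cnbhE vu Su] uv; split=> //; apply/nbhE.
Qed.

Lemma count_le_dom (v : vertex) (l : seq vertex) :
  uniq l -> all (king_close v) l -> (count (mem S) l <= dom S v)%N.
Proof.
move=> ul /allP vl; rewrite (eq_in_count (a2 := mem (detectors v))).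
  exact/count_le_vcard/ul/finite_detectors.
by move=> u /vl vu; rewrite /= mem_detectors vu.
Qed.

Lemma dom_le_count (v : vertex) (l : seq vertex) :
  uniq l -> (forall u, king_close v u -> u \in S -> u \in l) ->
  (dom S v <= count (mem S) l)%N.
Proof.
move=> ul Dl; rewrite /dom -/(detectors v) (vcard_count ul).
  by apply: sub_count => u; rewrite mem_detectors => /andP[].
by move=> u [/cnbhE vu Su]; apply: Dl => //; exact: mem_set.
Qed.

Definition light (v : vertex) : bool := dom S v == 2%N.

Definition heavy (v : vertex) : bool := (4 <= dom S v)%N.

Lemma light_count_le2 (v : vertex) (l : seq vertex) :
  uniq l -> all (king_close v) l -> light v -> (count (mem S) l <= 2)%N.
Proof. by move=> ul vl /eqP<-; exact: count_le_dom. Qed.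

Definition detector_pair (x y : vertex) : bool :=
  [&& x != y, x \in S & y \in S].

Lemma light_detectors (x y v w : vertex) :
  detector_pair x y -> sees x y v -> light v ->
  king_close v w -> w \in S -> w = x \/ w = y.
Proof.
case/and3P=> xy xS yS /andP[vx vy] lv vw wS.
have [->|wx] := eqVneq w x; [by left|have [->|wy] := eqVneq w y; [by right|]].
have := @light_count_le2 v [:: w; x; y].
by rewrite /= !inE negb_or wx wy xy vw vx vy wS xS yS => /(_ isT isT lv).
Qed.

Lemma light_detectors_sub (x y u v : vertex) :
  detector_pair x y -> sees x y u -> sees x y v -> light v ->
  (detectors v `<=` detectors u)%classic.
Proof.
move=> xy /andP[ux uy] xyv lv w [/cnbhE vw /mem_set wS].
split; last exact: set_mem.
by apply/cnbhE; case: (light_detectors xy xyv lv vw wS) => ->.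
Qed.

Definition excess_le (k : nat) (l : seq vertex) : bool :=
  (2 * count light l <= k + count heavy l)%N.

Lemma excess_le_count (k : nat) (l : seq vertex) :
  (count light l <= k)%N -> excess_le (2 * k) l.
Proof.
by move=> lk; rewrite /excess_le (leq_trans _ (leq_addr _ _))// leq_mul2l.
Qed.

Lemma excess_le_size (l : seq vertex) : excess_le (2 * size l) l.
Proof. by apply: excess_le_count; exact: count_size. Qed.

Lemma excess_le_none (l : seq vertex) :
  {in l, forall v, ~~ light v} -> excess_le 0 l.
Proof.
move=> nl; apply: (@excess_le_count 0).
by rewrite leqn0 eqn0Ngt -has_count -all_predC; exact/allP.
Qed.

Lemma excess_le_cat (j k : nat) (l m : seq vertex) :
  excess_le j l -> excess_le k m -> excess_le (j + k) (l ++ m).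
Proof. by rewrite /excess_le !count_cat mulnDr addnACA; exact: leq_add. Qed.

Lemma eq_excess_le (k : nat) (l m : seq vertex) :
  perm_eq l m -> excess_le k l = excess_le k m.
Proof. by move=> /permP lm; rewrite /excess_le !lm. Qed.

Lemma excess_le_pair (u v : vertex) :
  (light u -> heavy v) -> (light v -> heavy u) -> excess_le 1 [:: u; v].
Proof.
rewrite /excess_le /light /heavy /=.
move: (dom S u) (dom S v) => k1 k2; lia.
Qed.

Lemma excess_le_corners (u v w z : vertex) :
  (light u -> heavy v && heavy w) ->
  (light v || light w -> heavy u && ~~ light z) ->
  (light v && light w -> heavy z) ->
  excess_le 2 [:: u; v; w; z].
Proof.
rewrite /excess_le /light /heavy /=.
move: (dom S u) (dom S v) (dom S w) (dom S z) => k1 k2 k3 k4; lia.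
Qed.

End Detectors.

Section Redundant.
Variables (S : set vertex) (redS : redld S).

Lemma redld_dom_ge2 (v : vertex) : (2 <= dom S v)%N.
Proof. by case: redS => + _ _; apply. Qed.

Lemma redld_detectors_neq (u v : vertex) :
  u != v -> ~~ ((u \in S) && (v \in S)) -> detectors S u <> detectors S v.
Proof.
wlog vS : u v / v \notin S => [wlogH uv nuv|/eqP uv _ Duv].
  case/nandP: (nuv) => [uS Duv|vS]; last exact: wlogH.
  by apply: (wlogH v u) => //; rewrite 1?eq_sym// andbC.
case: redS => _ locating separating.
have nSv : ~ S v by rewrite -notin_setE.
have [uS|uS] := boolP (u \in S).
  have := locating u v (set_mem uS) nSv.
  rewrite open_detectors_detector (open_detectors_nondetector vS) -Duv.
  rewrite (_ : _ `\ _ = set0)%classic ?/vcard ?fset_set0 ?cardfs0//.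
  by apply/seteqP; split=> // w [[[[Duw _] nDuw]|[Duw nDuw]] wu]; case: nDuw.
have nSu : ~ S u by rewrite -notin_setE.
have := separating u v nSu nSv uv.
by rewrite !open_detectors_nondetector// Duv setYK /vcard fset_set0 cardfs0.
Qed.

Lemma redld_dom_lt (u v : vertex) : u != v -> ~~ ((u \in S) && (v \in S)) ->
  (detectors S u `<=` detectors S v)%classic -> (dom S u < dom S v)%N.
Proof.
move=> uv nuv Duv; apply: ltn_vcard => //; first exact: finite_detectors.
exact: redld_detectors_neq.
Qed.

Lemma redld_dom_add2_le (u v : vertex) :
  u != v -> u \notin S -> v \notin S ->
  (detectors S u `<=` detectors S v)%classic -> (dom S u + 2 <= dom S v)%N.
Proof.
move=> /eqP uv uS vS Duv; case: redS => _ _ separating.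
have nSu : ~ S u by rewrite -notin_setE.
have nSv : ~ S v by rewrite -notin_setE.
move: (separating u v nSu nSv uv).
rewrite !open_detectors_nondetector// setYC setY_def.
have -> : (detectors S u `\` detectors S v = set0)%classic by rewrite setD_eq0.
rewrite set0U vcardD//; last exact: finite_detectors.
by rewrite /dom -/(detectors S u) -/(detectors S v); lia.
Qed.

Lemma light_excludes (x y u v : vertex) :
  detector_pair S x y -> sees x y u -> sees x y v -> u != v ->
  ~~ ((u \in S) && (v \in S)) -> light S v -> ~~ light S u.
Proof.
move=> xy xyu xyv uv nuv lv; have Dvu := light_detectors_sub xy xyu xyv lv.
have := redld_dom_lt _ _ Dvu.
rewrite eq_sym uv andbC nuv (eqP lv) => /(_ isT isT).
by rewrite /light; case: ltngtP.
Qed.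

Lemma light_forces_heavy (x y u v : vertex) :
  detector_pair S x y -> sees x y u -> sees x y v -> u != v ->
  u \notin S -> v \notin S -> light S v -> heavy S u.
Proof.
move=> xy xyu xyv uv uS vS lv; have Dvu := light_detectors_sub xy xyu xyv lv.
by have := redld_dom_add2_le _ vS uS Dvu; rewrite eq_sym uv (eqP lv); apply.
Qed.

Lemma two_light_seen_pair (x y u v : vertex) :
  detector_pair S x y -> sees x y u -> sees x y v -> u != v ->
  light S u -> light S v -> light S x && light S y.
Proof.
move=> xy xyu xyv uv lu lv.
have /andP[uS vS] : (u \in S) && (v \in S).
  by apply: contraLR lu => nuv; apply: light_excludes xyv uv nuv lv.
have := light_detectors xy xyu lu (king_closexx u) uS.
have := light_detectors xy xyv lv (king_closexx v) vS.
by case=> vE [uE|uE]; move: uv; rewrite uE vE ?eqxx// -uE -vE lu lv.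
Qed.

Lemma excess_le_seen_pair (x y : vertex) (l : seq vertex) :
  detector_pair S x y -> uniq l -> all (sees x y) l ->
  ~~ (light S x && light S y) -> excess_le S 2 l.
Proof.
move=> xy ul /allP xyl nlight; apply: (@excess_le_count S 1).
rewrite -size_filter; have := filter_uniq (light S) ul.
have : {in [seq v <- l | light S v], forall v, light S v /\ sees x y v}.
  by move=> v; rewrite mem_filter => /andP[lv /xyl].
case: [seq v <- l | light S v] => [|u [|v s]]//= luv.
rewrite inE negb_or => /andP[/andP[uv _] _].
have [lu xyu] := luv u (mem_head _ _).
have [lv xyv] : light S v /\ sees x y v by apply: luv; rewrite !inE eqxx orbT.
by case/negP: nlight; apply: two_light_seen_pair xyu xyv uv lu lv.
Qed.

End Redundant.

(** * Share and excess of light vertices *)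

Definition ball (x : vertex) : seq vertex :=
  [seq (i, j) | i <- [:: x.1 - 1; x.1; x.1 + 1],
                j <- [:: x.2 - 1; x.2; x.2 + 1]].

Lemma ball_uniq (x : vertex) : uniq (ball x).
Proof.
case: x => a b; apply: allpairs_uniq => [||[i j] [k l] _ _ [-> ->]]//=;
  by rewrite !inE negb_or; lia.
Qed.

Lemma mem_ball (x v : vertex) : (v \in ball x) = king_close x v.
Proof.
case: v => a b; rewrite /king_close /=; apply/allpairsP/idP => /=.
  by case=> -[i j] /= []; rewrite !inE => ? ? [-> ->]; lia.
by move=> xv; exists (a, b); rewrite /= !inE; split=> //; lia.
Qed.

Definition balanced (S : set vertex) (x : vertex) : bool :=
  excess_le S 8 (ball x).

Lemma share_ball (R : realType) (S : set vertex) (x : vertex) :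
  share R S x = \sum_(u <- ball x) (dom S u)%:R^-1.
Proof.
rewrite fsbig_seq ?ball_uniq//; congr (\big[_/_]_(_ \in _) _).
by apply/seteqP; split=> u; rewrite /= mem_ball; move/cnbhE.
Qed.

Lemma inv_le_light_heavy (R : realFieldType) (k : nat) : (2 <= k)%N ->
  k%:R^-1 <= 3^-1 + (k == 2%N)%:R / 6 - (4 <= k)%N%:R / 12 :> R.
Proof.
case: k => [|[|[|[|k]]]]// _; rewrite /=; try lra.
have k4 : 4 <= k.+4%:R :> R by rewrite ler_nat.
have : k.+4%:R^-1 <= 4^-1 :> R by rewrite lef_pV2// posrE; lra.
by rewrite /= mul0r mul1r; move: k.+4%:R^-1 => r; lra.
Qed.

Lemma balanced_share_le (R : realType) (S : set vertex) (x : vertex) :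
  redld S -> balanced S x -> share R S x <= 11 / 3.
Proof.
move=> redS bal; rewrite share_ball.
apply: le_trans (_ : \sum_(u <- ball x)
    (3^-1 + (light S u)%:R / 6 - (heavy S u)%:R / 12) <= _).
  by apply: ler_sum => u _; apply: inv_le_light_heavy; exact: redld_dom_ge2.
have sum_count (P : pred vertex) (r : R) :
    \sum_(u <- ball x) (P u)%:R * r = (count P (ball x))%:R * r.
  by rewrite -mulr_suml -natr_sum -sumn_count sumnE big_map.
rewrite big_split sumrN big_split /= !sum_count big_const_seq count_predT.
rewrite iter_addr_0 -mulr_natl.
move: bal; rewrite /balanced /excess_le -(ler_nat R) natrM natrD /=; lra.
Qed.

(** * Symmetries of the king grid *)

Definition king_automorphism (f : vertex -> vertex) : Prop :=
  bijective f /\ forall u v, king_close (f u) (f v) = king_close u v.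

Section Automorphism.
Variables (f : vertex -> vertex) (autf : king_automorphism f).

Let f_bij : bijective f := autf.1.

Lemma nbh_preimage (v : vertex) : (f @^-1` nbh (f v))%classic = nbh v.
Proof.
apply/seteqP; split=> u /= /nbhE[vu uv]; apply/nbhE; move: vu uv.
  by rewrite autf.2 => vu fuv; split=> // uv; rewrite uv in fuv.
by rewrite -autf.2 => vu uv; split=> // /(bij_inj f_bij).
Qed.

Lemma cnbh_preimage (v : vertex) : (f @^-1` cnbh (f v))%classic = cnbh v.
Proof.
by apply/seteqP; split=> u /= /cnbhE vu; apply/cnbhE; move: vu;
  rewrite autf.2.
Qed.

Lemma dom_preimage (S : set vertex) (v : vertex) :
  dom (f @^-1` S)%classic v = dom S (f v).
Proof.
rewrite /dom -cnbh_preimage -preimage_setI vcard_preimage//.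
exact: finite_detectors.
Qed.

Lemma light_preimage (S : set vertex) (v : vertex) :
  light (f @^-1` S)%classic v = light S (f v).
Proof. by rewrite /light dom_preimage. Qed.

Lemma heavy_preimage (S : set vertex) (v : vertex) :
  heavy (f @^-1` S)%classic v = heavy S (f v).
Proof. by rewrite /heavy dom_preimage. Qed.

Lemma redld_preimage (S : set vertex) : redld S -> redld (f @^-1` S)%classic.
Proof.
case=> dominating locating separating.
have finN v : finite_set (nbh v `&` S)%classic.
  by apply: sub_finite_set (finite_nbh v) => u [].
have finY u v : finite_set ((nbh v `&` S) `+` (nbh u `&` S))%classic.
  by rewrite setY_def finite_setU; split; exact: finite_setD.
have diffE u v : (nbh v `&` f @^-1` S `+` nbh u `&` f @^-1` S =
    f @^-1` ((nbh (f v) `&` S) `+` (nbh (f u) `&` S)))%classic.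
  by rewrite -(nbh_preimage v) -(nbh_preimage u).
split=> [v|v u Sv Su|u v Su Sv uv].
- by rewrite -/(dom _ v) dom_preimage; exact: dominating.
- have -> : [set v]%classic = (f @^-1` [set f v])%classic.
    by apply/seteqP; split=> w /= => [->|/(bij_inj f_bij)].
  rewrite diffE setDE preimage_setC -preimage_setI -setDE vcard_preimage//.
    exact: locating.
  exact: finite_setD.
- by rewrite diffE vcard_preimage//; apply: separating => // /(bij_inj f_bij).
Qed.

Lemma balanced_preimage (S : set vertex) (x : vertex) :
  balanced (f @^-1` S)%classic x = balanced S (f x).
Proof.
have fball : perm_eq (map f (ball x)) (ball (f x)).
  apply: uniq_perm; rewrite ?map_inj_uniq ?ball_uniq//; first exact: bij_inj.
  move=> v; have [g fK gK] := f_bij; rewrite mem_ball.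
  by rewrite -{1}[v]gK (mem_map (bij_inj f_bij)) mem_ball -autf.2 gK.
rewrite /balanced -(eq_excess_le _ _ fball) /excess_le !count_map.
by rewrite (eq_count (light_preimage S)) (eq_count (heavy_preimage S)).
Qed.

End Automorphism.

Definition translate (x v : vertex) : vertex := (x.1 + v.1, x.2 + v.2).

Definition swap (v : vertex) : vertex := (v.2, v.1).

Definition mirror (v : vertex) : vertex := (v.1, - v.2).

Lemma translate_automorphism (x : vertex) : king_automorphism (translate x).
Proof.
split; last by move=> u v; rewrite /king_close /=; lia.
by exists (translate (- x.1, - x.2)) => -[a b];
  rewrite /translate /= ?addKr ?addNKr.
Qed.

Lemma swap_automorphism : king_automorphism swap.
Proof.
by split=> [|u v]; [exists swap; case|rewrite /king_close andbC].
Qed.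

Lemma mirror_automorphism : king_automorphism mirror.
Proof.
split; last by move=> u v; rewrite /king_close /=; lia.
by exists mirror => -[a b]; rewrite /mirror /= opprK.
Qed.

(** * The neighbourhood of the origin *)

Definition west_free (S : set vertex) : Prop :=
  forall v, king_close (0, 0) v -> v.1 <= 0 -> v != (0, 0) -> v \notin S.

Definition orthogonal : seq vertex := [:: (1, 0); (0, 1); (0, -1); (-1, 0)].

Definition diagonal : seq vertex := [:: (1, 1); (1, -1); (-1, 1); (-1, -1)].

Lemma neighbour_cases (v : vertex) : king_close (0, 0) v -> v != (0, 0) ->
  v \in orthogonal \/ v \in diagonal.
Proof.
rewrite -mem_ball => v_ball v0; apply/orP; move: v_ball v0; rewrite !inE.
by do 8!(case/orP=> [/eqP->//|]); move/eqP->.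
Qed.

Definition west_column : seq vertex := [:: (-1, 0); (-1, -1); (-1, 1)].

Lemma in_west_free (S : set vertex) :
  {in [:: (0, 1), (0, -1) & west_column], forall v, v \notin S} -> west_free S.
Proof.
move=> nonS v vclose v_west v0; apply: nonS; move: v_west.
by case: (neighbour_cases vclose v0); rewrite !inE => /or4P[] /eqP->.
Qed.

Lemma west_free_mirror (S : set vertex) :
  west_free S -> west_free (mirror @^-1` S)%classic.
Proof.
move=> wS [a b] ab a0 ab0; apply: (wS (mirror (a, b))) => //.
  by rewrite -[(0, 0)]/(mirror (0, 0)) mirror_automorphism.2.
by rewrite /mirror xpair_eqE oppr_eq0 -xpair_eqE.
Qed.

Section AroundOrigin.
Variables (S : set vertex) (redS : redld S) (S0 : (0, 0) \in S).

Lemma origin_pair (y : vertex) :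
  y \in S -> y != (0, 0) -> detector_pair S (0, 0) y.
Proof. by move=> Sy y0; rewrite /detector_pair eq_sym y0 S0. Qed.

Lemma dom_west_le : west_free S ->
  (dom S (-1, 0)%R <=
   1 + ((-2, -1)%R \in S) + ((-2, 0)%R \in S) + ((-2, 1)%R \in S))%N.
Proof.
move=> wS.
have := @dom_le_count S (-1, 0) [:: (0, 0); (-2, -1); (-2, 0); (-2, 1)].
rewrite /= S0 addn0 !addnA; apply=> // -[a b] ab; apply: contraLR.
rewrite !inE !xpair_eqE => nab.
by apply: wS; rewrite ?xpair_eqE; move: ab nab; rewrite /king_close /=; lia.
Qed.

Lemma light_northwest_heavy :
  west_free S -> light S (-1, 1) -> heavy S (-1, -1).
Proof.
move=> wS lightNW.
have nonSW : (-1, -1) \notin S by apply: wS.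
have nonW : (-1, 0) \notin S by apply: wS.
have nonNW : (-1, 1) \notin S by apply: wS.
have domNW : (1 + ((-2, 0)%R \in S) + ((-2, 1)%R \in S) <= 2)%N.
  have := @light_count_le2 S (-1, 1) [:: (0, 0); (-2, 0); (-2, 1)].
  by rewrite /= S0 addn0; exact.
have domW := dom_west_le wS.
(* Otherwise the west neighbour would be heavy, hence dominated by the whole
   column two steps west, and the northwest one would not be light. *)
have unshared y : y \in S -> y != (0, 0) -> king_close (-1, 1) y ->
    ~~ king_close (-1, 0) y.
  move=> Sy y0 yNW; apply/negP => yW; have pair := origin_pair Sy y0.
  have heavyW : heavy S (-1, 0).
    by apply: (light_forces_heavy redS pair _ _ _ nonW nonNW lightNW);
      rewrite // /sees ?yW ?yNW.
  by move: (leq_trans heavyW domW) domNW; do 3!case: (_ \in S).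
have nonWW : (-2, 0) \notin S by apply/negP => /unshared/(_ isT isT).
have nonWNW : (-2, 1) \notin S by apply/negP => /unshared/(_ isT isT).
have dom2W := redld_dom_ge2 redS (-1, 0).
have [S_WSW lightW] : (-2, -1) \in S /\ light S (-1, 0).
  move: domW; rewrite (negPf nonWW) (negPf nonWNW) !addn0 /light.
  case: (_ \in S) => domW; last by have := leq_trans dom2W domW.
  by rewrite eqn_leq domW.
have pair := origin_pair S_WSW isT.
exact: (light_forces_heavy redS pair _ _ _ nonSW nonW lightW).
Qed.

Lemma light_neighbours (z v : vertex) :
  light S (0, 0) -> z \in S -> z != (0, 0) -> king_close (0, 0) z ->
  king_close (0, 0) v -> v != (0, 0) -> v != z -> v \notin S.
Proof.
move=> light0 Sz z0 zclose vclose v0 vz; apply/negP => Sv.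
have sees0 : sees (0, 0) z (0, 0) by rewrite /sees zclose.
case: (light_detectors (origin_pair Sz z0) sees0 light0 vclose Sv) => /eqP;
  by apply/negP.
Qed.

Lemma light_origin_not_light (z v : vertex) :
  light S (0, 0) -> z \in S -> z != (0, 0) -> king_close (0, 0) z ->
  sees (0, 0) z v -> v != (0, 0) -> v != z -> ~~ light S v.
Proof.
move=> light0 Sz z0 zclose vsees v0 vz.
have sees0 : sees (0, 0) z (0, 0) by rewrite /sees zclose.
apply: (light_excludes redS (origin_pair Sz z0) vsees sees0 v0 _ light0).
rewrite (negPf (light_neighbours light0 Sz z0 zclose _ v0 vz))//.
by case/andP: vsees; rewrite king_closeC.
Qed.

Lemma dom_north_le : (1, 1) \in S -> light S (0, 0) ->
  (dom S (0, 1)%R <=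
   2 + ((-1, 2)%R \in S) + ((0, 2)%R \in S) + ((1, 2)%R \in S))%N.
Proof.
move=> S_NE light0.
have := @dom_le_count S (0, 1) [:: (0, 0); (1, 1); (-1, 2); (0, 2); (1, 2)].
rewrite /= S0 S_NE addn0 !addnA; apply=> // -[a b] ab; apply: contraLR.
rewrite !inE !xpair_eqE => nab; apply: (light_neighbours light0 S_NE) => //;
  by rewrite ?xpair_eqE; move: ab nab; rewrite /king_close /=; lia.
Qed.

Lemma light_northwest_detector :
  (1, 1) \in S -> light S (0, 0) -> light S (-1, 1) -> (1, 2) \in S.
Proof.
move=> S_NE light0 lightNW.
have nonN : (0, 1) \notin S by apply: (light_neighbours light0 S_NE).
have nonNW : (-1, 1) \notin S by apply: (light_neighbours light0 S_NE).
have domNW : (1 + ((-1, 2)%R \in S) + ((0, 2)%R \in S) <= 2)%N.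
  have := @light_count_le2 S (-1, 1) [:: (0, 0); (-1, 2); (0, 2)].
  by rewrite /= S0 addn0; exact.
have domN : (2 < dom S (0, 1)%R)%N.
  have nlightN : ~~ light S (0, 1).
    exact: (light_origin_not_light light0 S_NE).
  by rewrite ltn_neqAle eq_sym nlightN redld_dom_ge2.
have shared y : y \in S -> y != (0, 0) ->
    sees (0, 0) y (0, 1) -> sees (0, 0) y (-1, 1) -> heavy S (0, 1).
  move=> Sy y0 yN yNW; have pair0y := origin_pair Sy y0.
  exact: (light_forces_heavy redS pair0y yN yNW _ nonN nonNW lightNW).
apply: contraLR (dom_north_le S_NE light0) => nonNNE.
rewrite (negPf nonNNE) addn0 -ltnNge.
have [S_NNW|nonNNW] := boolP ((-1, 2) \in S).
  apply: leq_trans (shared _ S_NNW isT isT isT).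
  by move: domNW; rewrite S_NNW; case: (_ \in S).
have [S_NN|nonNN] := boolP ((0, 2) \in S); last exact: domN.
by apply: leq_trans (shared _ S_NN isT isT isT).
Qed.

Lemma light_west_free (z : vertex) :
  light S (0, 0) -> z \in S -> king_close (0, 0) z -> 0 < z.1 -> west_free S.
Proof.
move=> light0 Sz zclose z_east v vclose v_west v0.
apply: (light_neighbours light0 Sz) => //.
  by apply: contraTneq z_east => ->.
by apply: contraTneq v_west => ->; rewrite -ltNge.
Qed.

Lemma excess_le_seen_origin (z : vertex) (l : seq vertex) :
  ~~ light S (0, 0) -> z \in S -> z != (0, 0) -> uniq l ->
  all (sees (0, 0) z) l -> excess_le S 2 l.
Proof.
move=> nlight0 Sz z0 ul zl.
apply: (excess_le_seen_pair redS (origin_pair Sz z0) ul zl).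
by rewrite negb_and nlight0.
Qed.

Lemma balanced_of_perm (k : nat) (l : seq vertex) :
  perm_eq l (ball (0, 0)) -> (k <= 8)%N -> excess_le S k l -> balanced S (0, 0).
Proof.
move=> lball k8 lk; rewrite /balanced -(eq_excess_le S 8 lball).
by rewrite /excess_le (leq_trans lk)// leq_add2r.
Qed.

End AroundOrigin.

(** * Detectors around the origin *)

Section Balanced.
Variables (S : set vertex) (redS : redld S) (S0 : (0, 0) \in S).

Lemma light_southwest_heavy :
  west_free S -> light S (-1, -1) -> heavy S (-1, 1).
Proof.
move=> wS lightSW; rewrite -(heavy_preimage mirror_automorphism S (-1, -1)).
have redS' := redld_preimage mirror_automorphism redS.
apply: (light_northwest_heavy redS' S0 (west_free_mirror wS)).
by rewrite (light_preimage mirror_automorphism).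
Qed.

Lemma west_column_excess : west_free S -> excess_le S 3 west_column.
Proof.
move=> wS; have corners : excess_le S 1 [:: (-1, -1); (-1, 1)].
  apply: excess_le_pair; first exact: light_southwest_heavy.
  exact: light_northwest_heavy.
exact: excess_le_cat (excess_le_size S [:: (-1, 0)]) corners.
Qed.

Lemma balanced_east : (1, 0) \in S -> balanced S (0, 0).
Proof.
move=> S_E; pose sides : seq vertex := [:: (0, -1); (0, 1); (1, -1); (1, 1)].
have [/andP[light0 _]|nlight] := boolP (light S (0, 0) && light S (1, 0)).
  have sides_excess : excess_le S 0 sides.
    apply: excess_le_none => v vl.
    apply: (light_origin_not_light redS S0 light0 S_E) => //.
    - by move: v vl; apply/allP.
    - by apply: contraTneq vl => ->.
    - by apply: contraTneq vl => ->.
  have wS : west_free S by exact: light_west_free light0 S_E _ _.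
  have rest := excess_le_cat sides_excess (west_column_excess wS).
  have total := excess_le_cat (excess_le_size S [:: (0, 0); (1, 0)]) rest.
  exact: balanced_of_perm _ _ total.
have east : excess_le S 2 [:: (0, 0), (1, 0) & sides].
  by apply: (excess_le_seen_pair redS (origin_pair S0 S_E isT)).
have total := excess_le_cat east (excess_le_size S west_column).
exact: balanced_of_perm _ _ total.
Qed.

Lemma balanced_opposite :
  (1, 1) \in S -> (-1, -1) \in S -> balanced S (0, 0).
Proof.
move=> S_NE S_SW; have nlight0 : ~~ light S (0, 0).
  apply/negP => /(@light_count_le2 S (0, 0) [:: (0, 0); (1, 1); (-1, -1)]) /=.
  by rewrite S0 S_NE S_SW => /(_ isT isT).
have center : excess_le S 0 [:: (0, 0)].
  by apply: excess_le_none => v; rewrite inE => /eqP->.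
have NE : excess_le S 2 [:: (0, 1); (1, 0); (1, 1)].
  exact: excess_le_seen_origin nlight0 S_NE _ _ _.
have SW : excess_le S 2 [:: (0, -1); (-1, 0); (-1, -1)].
  exact: excess_le_seen_origin nlight0 S_SW _ _ _.
have corners := excess_le_size S [:: (1, -1); (-1, 1)].
have sides := excess_le_cat NE SW.
have total := excess_le_cat center (excess_le_cat sides corners).
exact: balanced_of_perm _ _ total.
Qed.

Lemma balanced_adjacent :
  west_free S -> (1, 1) \in S -> (1, -1) \in S -> balanced S (0, 0).
Proof.
move=> wS S_NE S_SE.
have nlight v : v \in [:: (0, 0); (1, 0)] -> ~~ light S v.
  move=> v_mid; apply/negP.
  move=> /(@light_count_le2 S v [:: (0, 0); (1, 1); (1, -1)] isT) /=.
  by rewrite S0 S_NE S_SE => /implyP/negP[]; move: v v_mid; apply/allP.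
have middle := excess_le_none nlight.
have nlight0 : ~~ light S (0, 0) by exact: nlight.
have NE : excess_le S 2 [:: (0, 1); (1, 1)].
  exact: excess_le_seen_origin nlight0 S_NE _ _ _.
have SE : excess_le S 2 [:: (0, -1); (1, -1)].
  exact: excess_le_seen_origin nlight0 S_SE _ _ _.
have east := excess_le_cat middle (excess_le_cat NE SE).
have total := excess_le_cat east (west_column_excess wS).
exact: balanced_of_perm _ _ total.
Qed.

Lemma light_origin_northwest : (1, 1) \in S -> light S (0, 0) ->
  (light S (-1, 1) -> heavy S (-1, -1) /\ (1, 2) \in S) /\
  (light S (-1, -1) -> heavy S (-1, 1)).
Proof.
move=> S_NE light0; have wS : west_free S by exact: light_west_free S_NE _ _.
split=> [lightNW|]; last exact: light_southwest_heavy.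
by split; [exact: light_northwest_heavy|exact: light_northwest_detector].
Qed.

End Balanced.

Section Cases.
Variables (S : set vertex) (redS : redld S) (S0 : (0, 0) \in S).

Lemma light_origin_southeast : (1, 1) \in S -> light S (0, 0) ->
  (light S (1, -1) -> heavy S (-1, -1) /\ (2, 1) \in S) /\
  (light S (-1, -1) -> heavy S (1, -1)).
Proof.
move=> S_NE; have redS' := redld_preimage swap_automorphism redS.
have := light_origin_northwest redS' S0 S_NE.
rewrite !(light_preimage swap_automorphism).
by rewrite !(heavy_preimage swap_automorphism).
Qed.

Lemma balanced_light : (1, 1) \in S -> light S (0, 0) -> balanced S (0, 0).
Proof.
move=> S_NE light0.
have [NW SW_NW] := light_origin_northwest redS S0 S_NE light0.
have [SE SW_SE] := light_origin_southeast S_NE light0.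
have NE_not_light y : y \in [:: (1, 2); (2, 1)] -> y \in S -> ~~ light S (1, 1).
  move=> y_far Sy; apply/negP.
  move=> /(@light_count_le2 S (1, 1) [:: (0, 0); (1, 1); y]) /=.
  rewrite S0 S_NE Sy.
  by move: y_far; rewrite !inE => /orP[] /eqP-> /(_ isT isT).
have corners : excess_le S 2 [:: (-1, -1); (-1, 1); (1, -1); (1, 1)].
  apply: excess_le_corners => [lightSW|/orP[/NW|/SE][-> S_y]|].
  - by apply/andP; split; [exact: SW_NW|exact: SW_SE].
  - exact: NE_not_light S_y.
  - exact: NE_not_light S_y.
  - case/andP=> /NW[_ S_NNE] /SE[_ S_ENE].
    have := @count_le_dom S (1, 1) [:: (0, 0); (1, 1); (1, 2); (2, 1)] isT isT.
    by rewrite /= S0 S_NE S_NNE S_ENE.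
have sides : excess_le S 0 [:: (0, 1); (1, 0)].
  apply: excess_le_none => v v_side.
  by apply: (light_origin_not_light redS S0 light0 S_NE) => //;
    move: v v_side; apply/allP.
have rest := excess_le_size S [:: (0, 0); (-1, 0); (0, -1)].
have total := excess_le_cat corners (excess_le_cat sides rest).
exact: balanced_of_perm _ _ total.
Qed.

End Cases.

Definition forces_balance (v : vertex) : Prop :=
  forall S, redld S -> (0, 0) \in S -> v \in S -> balanced S (0, 0).

Lemma forces_balance_image (f : vertex -> vertex) (v : vertex) :
  king_automorphism f -> f (0, 0) = (0, 0) ->
  forces_balance v -> forces_balance (f v).
Proof.
move=> autf f0 vforces S redS S0 Sfv.
by rewrite -[in balanced S _]f0 -(balanced_preimage autf); apply: vforces;
  [exact: redld_preimage|rewrite in_setE /= f0 -in_setE|].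
Qed.

Lemma forces_balance_orthogonal (v : vertex) :
  v \in orthogonal -> forces_balance v.
Proof.
have east : forces_balance (1, 0) by exact: balanced_east.
have north := forces_balance_image swap_automorphism erefl east.
have south := forces_balance_image mirror_automorphism erefl north.
have west := forces_balance_image swap_automorphism erefl south.
by rewrite !inE => /or4P[] /eqP->.
Qed.

Lemma forces_balance_northeast : forces_balance (1, 1).
Proof.
move=> S redS S0 S_NE.
have [/hasP[v v_orth Sv]|] := boolP (has (mem S) orthogonal).
  exact: (forces_balance_orthogonal v_orth).
move=> /hasPn nonS_orth.
have [S_SW|nonSW] := boolP ((-1, -1) \in S); first exact: balanced_opposite.
have [S_SE|nonSE] := boolP ((1, -1) \in S);
  have [S_NW|nonNW] := boolP ((-1, 1) \in S).
- rewrite -[(0, 0)]/(mirror (0, 0)) -(balanced_preimage mirror_automorphism).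
  exact: (balanced_opposite (redld_preimage mirror_automorphism redS)).
- apply: balanced_adjacent => //; apply: in_west_free => v.
  by rewrite !inE => /or4P[|||/orP[]] /eqP->//; apply: nonS_orth.
- rewrite -[(0, 0)]/(swap (0, 0)) -(balanced_preimage swap_automorphism).
  apply: (balanced_adjacent (redld_preimage swap_automorphism redS)) => //.
  apply: in_west_free => v.
  by rewrite !inE => /or4P[|||/orP[]] /eqP->//; apply: nonS_orth.
- apply: balanced_light => //.
  rewrite /light eqn_leq redld_dom_ge2// andbT.
  apply: leq_trans (_ : (count (mem S) [:: (0, 0); (1, 1)]%R <= 2)%N).
    apply: dom_le_count => // v vclose; apply: contraLR.
    rewrite [v \in _]inE negb_or => /andP[v0].
    have [/nonS_orth//|] := neighbour_cases vclose v0.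
    by rewrite !inE => /or4P[] /eqP->.
  exact: count_size.
Qed.

Lemma forces_balance_neighbour (v : vertex) :
  king_close (0, 0) v -> v != (0, 0) -> forces_balance v.
Proof.
have northeast := forces_balance_northeast.
have southeast := forces_balance_image mirror_automorphism erefl northeast.
have northwest := forces_balance_image swap_automorphism erefl southeast.
have southwest := forces_balance_image mirror_automorphism erefl northwest.
move=> vclose v0.
have [/forces_balance_orthogonal//|] := neighbour_cases vclose v0.
by rewrite !inE => /or4P[] /eqP->.
Qed.

Lemma balanced_detector (S : set vertex) (x : vertex) :
  redld S -> x \in S -> balanced S x.
Proof.
wlog -> : S x / x = (0, 0) => [origin redS Sx|redS S0].
  have x_image : translate x (0, 0) = x.
    by rewrite /translate !addr0 -surjective_pairing.
  rewrite -x_image -(balanced_preimage (translate_automorphism x)).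
  apply: origin => //.
    exact: (redld_preimage (translate_automorphism x) redS).
  by rewrite in_setE /= x_image -in_setE.
have [v [vclose Sv v0]] :
    exists v, [/\ king_close (0, 0) v, v \in S & v != (0, 0)].
  apply: contrapT => alone; have := redld_dom_ge2 redS (0, 0).
  apply/negP; rewrite -ltnNge ltnS.
  apply: leq_trans (_ : (count (mem S) [:: (0, 0)%R] <= 1)%N).
    apply: dom_le_count => // v vclose Sv; rewrite inE.
    by apply/negPn/negP => v0; apply: alone; exists v.
  exact: count_size.
exact: forces_balance_neighbour vclose v0 S redS S0 Sv.
Qed.

Lemma average_share_le (R : realType) (S : set vertex) (c : R) :
  0 <= c -> (forall x, S x -> share R S x <= c) ->
  (average_share R S <= c%:E)%E.
Proof.
move=> c0 share_le; apply: ge_ereal_inf; eexists.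
  by exists setT; [exact: filterT|reflexivity].
apply: ge_ereal_sup => _ [n _ <-]; rewrite lee_fin.
have finSn : finite_set (S `&` box n)%classic.
  by apply: sub_finite_set (finite_box n) => v [].
rewrite fsbig_finite//= /vcard; set A := fset_set _.
have [->|A_gt0] := eqVneq #|` A| 0%N; first by rewrite invr0 mul0r.
rewrite mulrC ler_pdivrMr ?ltr0n ?lt0n// mulr_natr.
rewrite -iter_addr_0 -(count_predT A) -(big_const_seq 0 +%R A predT) !big_seq.
apply: ler_sum => x; rewrite in_fset_set// => /set_mem[Sx _].
exact: share_le.
Qed.

Theorem theorem6 (R : realType) (S : set vertex) (hS : redld S) :
  (average_share R S <= (11%:R / 3%:R)%:E)%E.
Proof.
apply: average_share_le => [|x Sx]; first by rewrite divr_ge0.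
apply: balanced_share_le => //.
by apply: balanced_detector => //; exact/mem_set.
Qed.
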